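(* Let $z_1,z_2,z_3\in\mathbb C$ be three roots of unity whose product is $1$. Then the triple $(z_1,z_2,z_3)$ is an admissible starting triple in $\mathbb C$ with $\sigma$ complex conjugation (with $R$ the ring of integral elements of $\mathbb C$ and $P$ the positive real numbers).
   Context: $R\subset\mathbb C$ is the subring of elements that are roots of monic polynomials with integer coefficients, and the positive structure $P$ on $(\mathbb C,\sigma)$ is the set of positive real numbers. For a triple $(a,b,c)$ of invertible elements, the noncommutative angles are the six elements $\sigma(a^{-1})b\sigma(c^{-1})$, $\sigma(b^{-1})c\sigma(a^{-1})$, $\sigma(c^{-1})a\sigma(b^{-1})$, $\sigma(c^{-1})b\sigma(a^{-1})$, $\sigma(a^{-1})c\sigma(b^{-1})$, $\sigma(b^{-1})a\sigma(c^{-1})$. An admissible starting triple for $(R,P)$ is a triple $(a,b,c)$ such that $a,b,c$ are units in $R$ and all six noncommutative angles lie in $P$. *)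

(* Defs.v *)
From HB Require Import structures.
From mathcomp Require Import all_boot all_order all_algebra.
From mathcomp Require Import classical_sets reals complex.

Set Implicit Arguments.
Unset Strict Implicit.
Unset Printing Implicit Defensive.

Import Order.TTheory GRing.Theory Num.Theory.

Local Open Scope ring_scope.

Section AdmissibleTriples.
Variables (A : unitRingType) (sigma : A -> A).

Definition nc_angles (a b c : A) : seq A :=
  [:: sigma a^-1 * b * sigma c^-1;
      sigma b^-1 * c * sigma a^-1;
      sigma c^-1 * a * sigma b^-1;
      sigma c^-1 * b * sigma a^-1;
      sigma a^-1 * c * sigma b^-1;
      sigma b^-1 * a * sigma c^-1].

(* Units of the subring S itself: the inverse must also lie in S. *)
Definition unit_of_subring (S : set A) (x : A) : Prop :=
  S x /\ exists2 y, S y & x * y = 1 /\ y * x = 1.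

(* Units of S are invertible in A, so the inverses in nc_angles are genuine. *)
Definition admissible_starting_triple (S P : set A) (a b c : A) : Prop :=
  [/\ unit_of_subring S a, unit_of_subring S b, unit_of_subring S c
    & forall x, x \in nc_angles a b c -> P x].

End AdmissibleTriples.

Section ComplexCase.
Variable K : realType.

Definition integral_elements : set K[i] :=
  fun z => integralOver (intr : int -> K[i]) z.

Definition positive_reals : set K[i] :=
  fun z => exists2 r : K, 0 < r & z = real_complex K r.

(* n > 0 is needed: every z satisfies z ^+ 0 = 1. *)
Definition is_root_of_unity (z : K[i]) : Prop :=
  exists2 n : nat, (0 < n)%N & z ^+ n = 1.

End ComplexCase.

(* Main.v *)
Require Import Defs.
From mathcomp Require Import all_boot all_order all_algebra.
From mathcomp Require Import classical_sets reals complex.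
From mathcomp Require Import ring.

(** On the unit circle the inverse is the complex conjugate, so conjugation
    undoes inversion: the factors [conjc z^-1] in an angle collapse to [z].
    Each of the six angles is therefore the product of [z1], [z2], [z3] in some
    order, which is [1], a positive real. Units are no harder: a root of unity
    is integral, being a root of the monic polynomial ['X^n - 1], and its
    inverse is again a root of unity. *)

Import GRing.Theory Num.Theory.
Local Open Scope ring_scope.

Lemma root_of_unity_neq0 (K : realType) (z : K[i]) :
  is_root_of_unity z -> z != 0.
Proof.
case=> n n_gt0 zn1; apply/eqP => z0; move/eqP: zn1.
by rewrite z0 expr0n eqn0Ngt n_gt0 eq_sym oner_eq0.
Qed.

Lemma root_of_unityV (K : realType) (z : K[i]) :
  is_root_of_unity z -> is_root_of_unity z^-1.
Proof. by case=> n n_gt0 zn1; exists n; rewrite // exprVn zn1 invr1. Qed.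

Lemma root_of_unity_integral (K : realType) (z : K[i]) :
  is_root_of_unity z -> integral_elements z.
Proof.
case=> n n_gt0 zn1; exists ('X^n - 1); first exact: monicXnsubC.
by rewrite rmorphB /= map_polyXn rmorph1 rootE !hornerE zn1 subrr.
Qed.

Lemma root_of_unity_unit_integral (K : realType) (z : K[i]) :
  is_root_of_unity z -> unit_of_subring (@integral_elements K) z.
Proof.
move=> hz; have z_neq0 : z != 0 by exact: root_of_unity_neq0.
split; first exact: root_of_unity_integral.
exists z^-1; first exact/root_of_unity_integral/root_of_unityV.
by rewrite mulfV // mulVf.
Qed.

(** Here [z ^+ n = 1] forces [`|z| = 1], hence [z^-1] is the conjugate of [z],
    and conjugation is an involution. *)
Lemma conjc_root_of_unityV (K : realType) (z : K[i]) :
  is_root_of_unity z -> conjc z^-1 = z.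
Proof.
case=> n n_gt0 zn1.
have z_norm1 : `|z| = 1.
  by apply/eqP; rewrite -(pexpr_eq1 n_gt0) // -normrX zn1 normr1.
by rewrite invC_norm z_norm1 expr1n invr1 mul1r; exact: conjcK.
Qed.

Theorem proposition8p21 (K : realType) (z1 z2 z3 : K[i])
    (hz1 : is_root_of_unity z1) (hz2 : is_root_of_unity z2)
    (hz3 : is_root_of_unity z3) (hprod : z1 * z2 * z3 = 1) :
  admissible_starting_triple (@conjc K) (@integral_elements K)
    (@positive_reals K) z1 z2 z3.
Proof.
split; try exact: root_of_unity_unit_integral.
move=> x; rewrite /nc_angles !conjc_root_of_unityV // => x_angle.
suff -> : x = 1 by exists 1; rewrite ?ltr01 // rmorph1.
rewrite -hprod; move: x_angle; rewrite !inE.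
by do 5?[case/orP]; move/eqP=> ->; ring.
Qed.
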